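(* Let $n\geq 8$ be an integer with $n\not\equiv 1\pmod 3$. Let $\widetilde{L}$ be the $n\times n$ matrix $$\widetilde{L}=\frac{n-1}{3}I_n-\frac13\begin{bmatrix}0&\mathbf{e}'\\ \mathbf{e}&\mathbf{0}\end{bmatrix}+\begin{bmatrix}0&\mathbf{0}'\\ \mathbf{0}&M\end{bmatrix},$$ where $M=\frac13\operatorname{Circ}(\bar{\mathbf{x}}')$ if $n\equiv 2\pmod 3$ and $M=\frac13\operatorname{Circ}(\bar{\mathbf{y}}')$ if $n\equiv 0\pmod 3$, with $\bar{\mathbf{x}},\bar{\mathbf{y}}\in\mathbb{R}^{n-1}$ given by $$\bar{\mathbf{x}}=(2-n,\underbrace{1,-2,1},\dots,\underbrace{1,-2,1})',\qquad \bar{\mathbf{y}}=(-n,\underbrace{2,-1,-1},\dots,\underbrace{2,-1,-1},2)'.$$ Then $\widetilde{L}$ is a Laplacian-like matrix.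
   Context: A real square matrix $A$ is called Laplacian-like if $A\mathbf{e}=0$ and $\mathbf{e}'A=0$, where $\mathbf{e}$ is the all-ones column vector of the appropriate size. The prime denotes transpose and $I_n$ is the identity matrix. In the block matrices the blocks have sizes $1$ and $n-1$, and $\mathbf{e}$ there lies in $\mathbb{R}^{n-1}$. For a vector $\mathbf{c}=(c_1,\dots,c_m)'$, $\operatorname{Circ}(\mathbf{c}')$ is the $m\times m$ circulant matrix with first row $(c_1,\dots,c_m)$ and each subsequent row the cyclic right shift by one of the previous row. *)

(* Defs.v *)
From HB Require Import structures.
From mathcomp Require Import all_boot all_order all_algebra.
From mathcomp Require Import reals.
From mathcomp Require Import zify.

Set Implicit Arguments.
Unset Strict Implicit.
Unset Printing Implicit Defensive.

Import Order.TTheory GRing.Theory Num.Theory.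
Local Open Scope ring_scope.

Definition ones (R : realType) (n : nat) : 'cV[R]_n := const_mx 1.

Definition laplacian_like (R : realType) (n : nat) (A : 'M[R]_n) : Prop :=
  A *m ones R n = 0 /\ (ones R n)^T *m A = 0.

(* [ord_pred] is the cyclic predecessor in ['I_m], so row [i] is the row [c]
   cyclically shifted to the right [i] times. *)
Definition circ (R : realType) (m : nat) (c : 'rV[R]_m) : 'M[R]_m :=
  \matrix_(i, j) c 0 (iter i (@ord_pred m) j).

Definition xbar_seq (R : realType) (n : nat) : seq R :=
  (2 - n%:R) :: flatten (nseq ((n - 2) %/ 3)%N [:: 1; -2; 1]).

Definition ybar_seq (R : realType) (n : nat) : seq R :=
  - n%:R :: rcons (flatten (nseq ((n - 3) %/ 3)%N [:: 2; -1; -1])) 2.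

(* These lists have exactly [n - 1] entries in the residue classes where they
   are used, so the [nth] below never returns its default value. *)
Lemma size_xbar_seq (R : realType) (n : nat) :
  (n %% 3 = 2)%N -> size (xbar_seq R n) = n.-1.
Proof.
move=> hn; rewrite /= size_flatten /shape map_nseq sumn_nseq /=; lia.
Qed.

Lemma size_ybar_seq (R : realType) (n : nat) :
  (0 < n)%N -> (n %% 3 = 0)%N -> size (ybar_seq R n) = n.-1.
Proof.
move=> n_gt0 hn.
rewrite /= size_rcons size_flatten /shape map_nseq sumn_nseq /=; lia.
Qed.

Definition xbar (R : realType) (n : nat) : 'cV[R]_n.-1 :=
  \col_i nth 0 (xbar_seq R n) i.

Definition ybar (R : realType) (n : nat) : 'cV[R]_n.-1 :=
  \col_i nth 0 (ybar_seq R n) i.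

(* Only meant for [n] not congruent to 1 modulo 3: the last branch is the case
   [n] divisible by 3. *)
Definition Mblock (R : realType) (n : nat) : 'M[R]_n.-1 :=
  if (n %% 3 == 2)%N then 3^-1 *: circ (xbar R n)^T
  else 3^-1 *: circ (ybar R n)^T.

(* For [0 < n] the size [1 + n.-1] is [n]; it is written this way so that the
   matrix splits into blocks of sizes [1] and [n - 1]. *)
Definition Ltilde (R : realType) (n : nat) : 'M[R]_(1 + n.-1) :=
  ((n%:R - 1) / 3)%:M
  - 3^-1 *: block_mx 0 (ones R n.-1)^T (ones R n.-1) 0
  + block_mx 0 0 0 (Mblock R n).

(* Main.v *)
(** All column and row sums of a circulant matrix equal the sum of its first
    row, and here that sum is [(2 - n) / 3] in both residue classes because the
    repeated triples sum to zero. The border contributes [- 1 / 3] to each of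
    the last [n - 1] rows and columns, and [- (n - 1) / 3] to the first ones;
    both are balanced by the diagonal [(n - 1) / 3]. *)
Require Import Defs.
From mathcomp Require Import all_boot all_order all_algebra.
From mathcomp Require Import reals.
From mathcomp Require Import zify ring.

Import GRing.Theory.
Local Open Scope ring_scope.

(** Each predecessor step subtracts 1 modulo [m]. Moving [i] to the left-hand side avoids truncated
    subtraction. *)
Lemma iter_ord_pred_modn (m i : nat) (j : 'I_m) :
  (iter i (@ord_pred m) j + i = j %[mod m])%N.
Proof.
elim: i => [|i IHi]; first by rewrite addn0.
rewrite iterS -[RHS]IHi; set k := iter i _ j.
have m_gt0 : (0 < m)%N := leq_ltn_trans (leq0n j) (ltn_ord j).
rewrite modnDml; have -> : ((k + m).-1 + i.+1 = k + i + m)%N by lia.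
by rewrite modnDr.
Qed.

(** The residue [j - i] determines [i] below [m]. Hence each column of a circulant matrix meets
    every entry of [c] once, which gives the column sums. *)
Lemma iter_ord_pred_inj_exp (m : nat) (j : 'I_m) :
  injective (fun i : 'I_m => iter i (@ord_pred m) j).
Proof.
move=> i1 i2 /= eq12; apply: val_inj => /=.
have := iter_ord_pred_modn m i1 j; rewrite -(iter_ord_pred_modn m i2 j) eq12.
by move/eqP; rewrite eqn_modDl !modn_small // => /eqP.
Qed.

Lemma circ_mul_ones (R : realType) (m : nat) (c : 'rV[R]_m) :
  circ c *m ones R m = (\sum_j c 0 j) *: ones R m.
Proof.
apply/matrixP => i k; rewrite !mxE mulr1.
(* Along a fixed row, the column index is permuted by an iterate of an injective map. *)
have inj : injective (iter i (@ord_pred m)).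
  by elim: (nat_of_ord i) => [|l IHl] x y //= /ord_pred_inj /IHl.
by rewrite [RHS](reindex_inj inj); apply: eq_bigr => j _; rewrite !mxE mulr1.
Qed.

Lemma ones_mul_circ (R : realType) (m : nat) (c : 'rV[R]_m) :
  (ones R m)^T *m circ c = (\sum_j c 0 j) *: (ones R m)^T.
Proof.
apply/matrixP => k j; rewrite !mxE mulr1 [RHS](reindex_inj (iter_ord_pred_inj_exp m j)).
by apply: eq_bigr => i _; rewrite !mxE mul1r.
Qed.

Lemma sum_flatten_nseq (R : realType) (k : nat) (s : seq R) :
  \sum_(x <- flatten (nseq k s)) x = (\sum_(x <- s) x) *+ k.
Proof. by rewrite big_flatten big_nseq -Monoid.iteropE. Qed.

Lemma sum_col_nth (R : realType) (m : nat) (s : seq R) : size s = m ->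
  \sum_j (\col_(i < m) nth 0 s i)^T 0 j = \sum_(x <- s) x.
Proof.
by move=> <-; rewrite (big_nth 0) big_mkord; apply: eq_bigr => i _; rewrite !mxE.
Qed.

Lemma sum_xbar (R : realType) (n : nat) : (n %% 3 = 2)%N ->
  \sum_j (xbar R n)^T 0 j = 2 - n%:R.
Proof.
move=> n_mod3; rewrite sum_col_nth ?size_xbar_seq // big_cons sum_flatten_nseq.
rewrite !big_cons big_nil (_ : 1 + _ = 0); last by ring.
by rewrite mul0rn addr0.
Qed.

Lemma sum_ybar (R : realType) (n : nat) : (0 < n)%N -> (n %% 3 = 0)%N ->
  \sum_j (ybar R n)^T 0 j = 2 - n%:R.
Proof.
move=> n_gt0 n_mod3; rewrite sum_col_nth ?size_ybar_seq // big_cons.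
rewrite -cats1 big_cat sum_flatten_nseq /= !big_cons !big_nil.
rewrite (_ : 2 + (-1 + _) = 0); last by ring.
(* Only the head [- n] and the trailing [2] survive. *)
by rewrite mul0rn; ring.
Qed.

(** In the first block the diagonal [a] cancels the [k] border entries [- b]. In the second, [a - b]
    cancels the eigenvalue [b - a] of [M] on both sides. *)
Lemma laplacian_like_bordered (R : realType) (k : nat) (a b : R) (M : 'M[R]_k) :
    a = b * k%:R ->
    M *m ones R k = (b - a) *: ones R k ->
    (ones R k)^T *m M = (b - a) *: (ones R k)^T ->
  laplacian_like (a%:M - b *: block_mx 0 (ones R k)^T (ones R k) 0
                  + block_mx 0 0 0 M : 'M[R]_(1 + k)).
Proof.
move=> aE Mones onesM.
have onesE : ones R (1 + k) = col_mx (ones R 1) (ones R k).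
  by rewrite /ones -col_mx_const.
have ones1 : ones R 1 = 1%:M by apply/matrixP => i j; rewrite !mxE !ord1.
have sumk : (ones R k)^T *m ones R k = k%:R%:M.
  apply/matrixP => i j; rewrite !mxE !ord1 eqxx mulr1n.
  under eq_bigr => l _ do rewrite !mxE mulr1.
  by rewrite sumr_const card_ord.
rewrite /laplacian_like onesE tr_col_mx ones1 trmx1.
split.
- rewrite mulmxDl mulmxBl mul_scalar_mx -scalemxAl !mul_block_col.
  rewrite !mul0mx !add0r !mulmx1 !addr0 sumk Mones.
  rewrite !scale_col_mx opp_col_mx !add_col_mx scale_scalar_mx mulr1.
  rewrite scale_scalar_mx -aE subrr addr0 -scalerBl -scalerDl.
  by rewrite addrC subrKA subrr scale0r col_mx0.
- rewrite mulmxDr mulmxBr mul_mx_scalar -scalemxAr !mul_row_block.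
  rewrite !mulmx0 !add0r !mul1mx !addr0 sumk onesM.
  rewrite !scale_row_mx opp_row_mx !add_row_mx scale_scalar_mx mulr1.
  rewrite scale_scalar_mx -aE subrr addr0 -scalerBl -scalerDl.
  by rewrite addrC subrKA subrr scale0r row_mx0.
Qed.

Theorem theorem5p12 (R : realType) (n : nat) (n_ge8 : (8 <= n)%N)
  (n_mod3 : n <> 1 %[mod 3]) : laplacian_like (Ltilde R n).
Proof.
have n_gt0 : (0 < n)%N by lia.
(* Only the sum of the first row matters from here on, so both residue classes are treated at
   once. *)
have [c McircE sumc] : exists2 c : 'rV[R]_n.-1,
    Mblock R n = 3^-1 *: circ c & \sum_j c 0 j = 2 - n%:R.
  rewrite /Mblock; case: eqP => n_mod.
    by exists (xbar R n)^T; rewrite // sum_xbar.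
  by exists (ybar R n)^T; rewrite // sum_ybar //; lia.
have predn : n.-1%:R = n%:R - 1 :> R by rewrite -subn1 natrB.
(* This is the eigenvalue [b - a] for [b = 1/3] and [a = (n - 1)/3]. *)
have coefE : 3^-1 * (2 - n%:R) = 3^-1 - (n%:R - 1) / 3 :> R by field.
apply: laplacian_like_bordered; first by rewrite predn mulrC.
- by rewrite McircE -scalemxAl circ_mul_ones sumc scalerA coefE.
- by rewrite McircE -scalemxAr ones_mul_circ sumc scalerA coefE.
Qed.
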